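(* Let $s=[\alpha,\beta]$ with $\alpha<\beta$ be a segment, and for $\xi\in\mathbb{R}$ define $s+\xi:=\{x+\xi:\ x\in s\}$. Let $\xi_1,\dots,\xi_d$ be pairwise distinct real numbers and let $p_{d-1}$ be a real polynomial of degree at most $d-1$. If $$\int_{s+\xi_i}p_{d-1}(x)\,\mathrm{d}x=0\qquad\text{for each } i=1,\dots,d,$$ then $p_{d-1}(x)=0$ for each $x\in\mathbb{R}$. *)

(* Defs.v *)
From mathcomp Require Import all_boot all_order all_algebra.
From mathcomp Require Import all_classical all_reals all_analysis.

Set Implicit Arguments.
Unset Strict Implicit.
Unset Printing Implicit Defensive.

Import Order.TTheory GRing.Theory Num.Theory.
Local Open Scope classical_set_scope.
Local Open Scope ring_scope.

Definition translate (R : realType) (s : set R) (xi : R) : set R :=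
  [set x + xi | x in s].

(* Main.v *)
Require Import Defs.
From mathcomp Require Import all_boot all_order all_algebra.
From mathcomp Require Import all_classical all_reals all_analysis.

Set Implicit Arguments.
Unset Strict Implicit.
Unset Printing Implicit Defensive.

Import Order.TTheory GRing.Theory Num.Theory.
Local Open Scope classical_set_scope.
Local Open Scope ring_scope.

(** Let P be a polynomial with derivative p and degree at most d.  By the
    fundamental theorem of calculus the integral of p over s + t is the value
    at t of the polynomial Q(t) = P(t + beta) - P(t + alpha).  Both terms of Q
    have the same leading coefficient, so Q has degree at most d - 1
    ([size_comp_XaddC_sub]); it vanishes at the d distinct points xi_i, hence
    Q = 0.  This says that P is periodic with the nonzero period beta - alpha,
    and a periodic polynomial takes one of its values infinitely often, so it
    is constant ([periodic_poly_const]).  Therefore p = P' = 0. *)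

(** At index 0 the formula reads [p`_0 / 0], that is 0: this picks the
    antiderivative that vanishes at 0. *)
Definition antideriv (F : fieldType) (p : {poly F}) : {poly F} :=
  \poly_(i < (size p).+1) (p`_i.-1 / i%:R).

Lemma size_antideriv (F : fieldType) (p : {poly F}) :
  (size (antideriv p) <= (size p).+1)%N.
Proof. exact: size_poly. Qed.

Lemma deriv_antideriv (F : numFieldType) (p : {poly F}) :
  (antideriv p)^`() = p.
Proof.
apply/polyP => i; rewrite coef_deriv coef_poly ltnS /=.
case: ltnP => [_|hi]; first by rewrite -[LHS]mulr_natr divfK // pnatr_eq0.
by rewrite mul0rn nth_default.
Qed.

(** Translating the variable changes neither the degree nor the leading
    coefficient, so the top coefficients cancel in the difference. *)
Lemma size_comp_XaddC_sub (F : idomainType) (P : {poly F}) (a b : F) :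
  (size ((P \Po ('X + b%:P)) - (P \Po ('X + a%:P)))%R <= (size P).-1)%N.
Proof.
have szP c : size (P \Po ('X + c%:P)) = size P.
  by rewrite size_comp_poly2 // size_XaddC.
have leadP c : (P \Po ('X + c%:P))`_(size P).-1 = lead_coef P.
  rewrite -[in LHS](szP c) -lead_coefE lead_coef_comp ?size_XaddC //.
  by rewrite lead_coefXaddC expr1n mulr1.
apply/leq_sizeP => j; rewrite leq_eqVlt => /predU1P[<-|hj].
  by rewrite coefB !leadP subrr.
by rewrite coefB !nth_default ?subrr // szP; case: (size P) hj.
Qed.

(** P - P(0) has the infinitely many roots k h, for k a natural number. *)
Lemma periodic_poly_const (F : numFieldType) (P : {poly F}) (h : F) :
  h != 0 -> (forall t, P.[t + h] = P.[t]) -> P = (P.[0])%:P.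
Proof.
move=> h0 Ph; apply: subr0_eq.
set D := P - _.
apply: (@roots_geq_poly_eq0 _ _ [seq h *+ k | k <- iota 0 (size D)]).
- apply/allP => _ /mapP[k _ ->]; rewrite /root !hornerE subr_eq0.
  by elim: k => [|k IHk]; rewrite ?mulr0n // mulrSr Ph.
- rewrite map_inj_uniq ?iota_uniq // => i j /eqP.
  by rewrite -!(mulr_natr h) (inj_eq (mulfI h0)) eqr_nat => /eqP.
- by rewrite size_map size_iota.
Qed.

Lemma translate_itvcc (R : realType) (a b t : R) :
  translate `[a, b] t = `[a + t, b + t]%classic.
Proof.
apply/seteqP; split => [_ [x + <-]|y] /=; rewrite !in_itv /=.
  by rewrite !lerD2r.
by move=> hy; exists (y - t); rewrite ?subrK //= in_itv /= lerBrDr lerBlDr.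
Qed.

Lemma Rintegral_deriv_poly (R : realType) (P : {poly R}) (a b : R) :
  a < b ->
  \int[lebesgue_measure]_(x in `[a, b]) (P^`()).[x] = P.[b] - P.[a].
Proof.
move=> ab; rewrite /Rintegral (@continuous_FTC2 _ _ (horner P)) //.
- apply: derivable_within_continuous => x _; exact: derivable_horner.
- split => [x _||]; first exact: derivable_horner.
  + by apply: cvg_at_right_filter; exact: continuous_horner.
  + by apply: cvg_at_left_filter; exact: continuous_horner.
- by move=> x _; rewrite derivE.
Qed.

(* [size p] is the degree plus one, so [size p <= d] means degree <= d - 1. *)
Theorem proposition2p9 (R : realType) (alpha beta : R) (hs : alpha < beta)
  (d : nat) (hd : (0 < d)%N) (xi : 'I_d -> R) (hxi : injective xi)
  (p : {poly R}) (hp : (size p <= d)%N)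
  (hint : forall i : 'I_d,
    \int[lebesgue_measure]_(x in translate `[alpha, beta] (xi i)) p.[x] = 0) :
  forall x : R, p.[x] = 0.
Proof.
pose P := antideriv p.
pose Q := (P \Po ('X + beta%:P)) - (P \Po ('X + alpha%:P)).
have QE t : Q.[t] = P.[t + beta] - P.[t + alpha].
  by rewrite /Q hornerD hornerN !horner_comp !hornerE.
have Q0 : Q = 0.
  apply: (@roots_geq_poly_eq0 _ _ (codom xi)).
  - apply/allP => _ /codomP[i ->]; rewrite /root QE.
    have := hint i; rewrite translate_itvcc -{1}(deriv_antideriv p).
    by rewrite Rintegral_deriv_poly ?ltrD2r // !(addrC (xi i)) => ->.
  - exact/injectiveP.
  - rewrite size_codom card_ord (leq_trans (size_comp_XaddC_sub _ _ _)) //.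
    by rewrite (leq_trans _ hp) // -subn1 leq_subLR add1n size_antideriv.
have Pper t : P.[t + (beta - alpha)] = P.[t].
  have := QE (t - alpha); rewrite Q0 horner0 subrK => /esym/subr0_eq <-.
  by rewrite addrAC addrA.
move=> x; rewrite -(deriv_antideriv p) -/P (periodic_poly_const _ Pper).
  by rewrite derivC horner0.
by rewrite subr_eq0 gt_eqF.
Qed.
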